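(* For every integer $n\ge 2$, $$\overline{\mathrm{dist}}_T(\mathcal{DD}_n^*,\mathcal{S}^n_+)=\frac{\sqrt{n}-1}{2}.$$
   Context: Let $\mathbb{S}^n$ be the space of real symmetric $n\times n$ matrices with Frobenius norm $\|X\|_F=\sqrt{\sum_{i,j=1}^n X_{i,j}^2}$, and let $\mathcal{S}^n_+=\{X\in\mathbb{S}^n\mid d^TXd\ge 0 \text{ for all } d\in\mathbb{R}^n\}$ be the positive semidefinite cone. Define $$\mathcal{DD}_n^*:=\{X\in\mathbb{S}^n\mid X_{i,i}+X_{j,j}\pm 2X_{i,j}\ge 0\ (1\le i\le j\le n)\}$$ (both sign choices are required). Let $\mathrm{P}_{\mathcal{S}^n_+}(X):=\mathrm{argmin}_{Y\in\mathcal{S}^n_+}\|X-Y\|_F$ be the metric projection of $X$ onto $\mathcal{S}^n_+$, and $\mathrm{Tr}(X)=\sum_{i=1}^n X_{i,i}$. For a set $\mathcal{S}$ with $\mathcal{S}^n_+\subseteq\mathcal{S}\subseteq\mathbb{S}^n$, the trace normalized distance is $$\overline{\mathrm{dist}}_T(\mathcal{S},\mathcal{S}^n_+):=\sup_{X\in\mathcal{S},\ \mathrm{Tr}(X)=1}\|X-\mathrm{P}_{\mathcal{S}^n_+}(X)\|_F.$$ *)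

(* Defs.v *)
From mathcomp Require Import all_boot all_order all_algebra.
From mathcomp Require Import classical_sets reals ereal constructive_ereal.

Set Implicit Arguments.
Unset Strict Implicit.
Unset Printing Implicit Defensive.

Import Order.TTheory GRing.Theory Num.Theory.

Local Open Scope classical_set_scope.
Local Open Scope ring_scope.

Definition symm (R : realType) (n : nat) : set 'M[R]_n :=
  [set X | X \is symmetricmx].

(* The norm carried by matrices in MathComp-Analysis is the sup norm, hence
   this definition. *)
Definition frobenius_norm (R : realType) (n : nat) (X : 'M[R]_n) : R :=
  Num.sqrt (\sum_(i < n) \sum_(j < n) X i j ^+ 2).

Definition psd_cone (R : realType) (n : nat) : set 'M[R]_n :=
  [set X | @symm R n X /\ forall d : 'cV[R]_n, 0 <= (d^T *m X *m d) 0 0].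

Definition dd_dual (R : realType) (n : nat) : set 'M[R]_n :=
  [set X | @symm R n X /\ forall i j : 'I_n, (i <= j)%N ->
     0 <= X i i + X j j + 2 * X i j /\ 0 <= X i i + X j j - 2 * X i j].

Definition is_psd_proj (R : realType) (n : nat) (X Y : 'M[R]_n) : Prop :=
  @psd_cone R n Y /\ forall Z : 'M[R]_n, @psd_cone R n Z ->
    frobenius_norm (X - Y) <= frobenius_norm (X - Z).

(* The minimiser exists and is unique, the cone being nonempty, closed and
   convex; the default value 0 of xget is thus never selected for want of a
   minimiser. *)
Definition psd_proj (R : realType) (n : nat) (X : 'M[R]_n) : 'M[R]_n :=
  xget 0 [set Y | is_psd_proj X Y].

(* The supremum is taken in the extended reals: an equality with a finite value
   thus also asserts that the set of distances is bounded above and nonempty. *)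
Definition trace_dist (R : realType) (n : nat) (S : set 'M[R]_n) : \bar R :=
  ereal_sup [set (frobenius_norm (X - psd_proj X))%:E
            | X in [set X | S X /\ \tr X = 1]].

(* Main.v *)
Require Import Defs.
From mathcomp Require Import all_boot all_order all_algebra.
From mathcomp Require Import boolp classical_sets reals ereal constructive_ereal.
From mathcomp Require Import topology normedtype derive.
From mathcomp Require Import ring lra.

Set Implicit Arguments.
Unset Strict Implicit.
Unset Printing Implicit Defensive.

Import Order.TTheory GRing.Theory Num.Theory.
Import numFieldNormedType.Exports.
Local Open Scope classical_set_scope.
Local Open Scope ring_scope.

(** The supremum is bounded above by duality and attained at a star matrix.

    Write [frob] for the entrywise inner product of matrices.  If [Y] is the
    projection of [X] on the positive semidefinite cone, the first-order
    optimality condition says that the residual [P = Y - X] is positive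
    semidefinite and that [frob P Y <= 0]; hence [|P|^2 <= - frob X P], and it
    is enough to bound [- frob X P] linearly in [|P|].  For [X] in the dual
    cone, [|X i j| <= (X i i + X j j) / 2], so summing by rows gives

      [- frob X P <= \sum_i X i i * (\sum_(j != i) |P i j| - P i i)],

    an average, with weights of sum [\tr X = 1], of quantities that depend on
    one row of [P] only ([dd_dual_frob_ge]).  Let [a = P i i].  A column [p] of
    a positive semidefinite matrix satisfies [|p|^2 <= a |P|]
    ([psd_column_sqr_le]), so by Cauchy-Schwarz the off-diagonal row sum is at
    most [sqrt ((n - 1) a (|P| - a))].  Maximising this minus [a] over [a]
    gives [|P| (sqrt n - 1) / 2] ([psd_offdiag_le]).

    Equality in all these steps leads to a weight concentrated on one index
    [i0], with [X i0 j = - 1/2] for [j != i0]: this is the matrix [star].  Its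
    only negative eigenvalue is [- (sqrt n - 1) / 2], and a matrix with
    eigenvalue [- l] is at distance at least [l] from the cone
    ([eigenvalue_dist_psd_ge]).

    All of this concerns an actual minimiser, so the projection must be shown
    to exist: the cone is closed, and the Frobenius distance attains its
    minimum on a compact part of it ([psd_proj_exists]). *)

(** * Two facts about real quadratics *)

Lemma discriminant_le (R : realFieldType) (a b c : R) : 0 <= c ->
  (forall t, 0 <= a + 2 * t * b + t ^+ 2 * c) -> b ^+ 2 <= a * c.
Proof.
rewrite le_eqVlt => /predU1P[<-|c0] H.
  have [->|b0] := eqVneq b 0; first by rewrite expr0n mulr0.
  have := H (- (a + 1) / (2 * b)).
  rewrite (_ : a + _ + _ = -1); first by lra.
  by field.
have := H (- b / c).
rewrite (_ : a + _ + _ = (a * c - b ^+ 2) / c); last by field; rewrite gt_eqF.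
by rewrite pmulr_lge0 ?invr_gt0 // subr_ge0.
Qed.

(** First-order condition: if [0] minimises the quadratic on the unit interval,
    its derivative there is nonnegative. *)
Lemma unit_interval_quadratic_ge0 (R : realFieldType) (b c : R) :
  (forall t, 0 <= t <= 1 -> 0 <= 2 * t * b + t ^+ 2 * c) -> 0 <= b.
Proof.
move=> H; rewrite leNgt; apply/negP => b0.
have [c0|c0] := lerP c 0.
  by have := H 1; rewrite lexx ler01 => /(_ isT); lra.
have k0 : 0 < c - b by lra.
(* For c > 0 the quadratic is negative on ]0, -2b/c[; this point lies in that
   interval and, unlike the minimiser -b/c, is always at most 1. *)
pose t := - b / (c - b).
have t0 : 0 < t by rewrite divr_gt0 // oppr_gt0.
have : 0 <= t <= 1 by rewrite (ltW t0) ler_pdivrMr //; lra.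
move=> /H; have -> : 2 * t * b + t ^+ 2 * c = t * (b * (c - 2 * b) / (c - b)).
  by rewrite /t; field; rewrite gt_eqF.
by rewrite pmulr_rge0 // pmulr_lge0 ?invr_gt0 //; nra.
Qed.

(** * The Frobenius inner product *)

Section FrobeniusProduct.
Context {R : realType} {n : nat}.
Implicit Types (X Y Z P : 'M[R]_n) (d e : 'cV[R]_n).

Definition frob X Y : R := \sum_(i < n) \sum_(j < n) X i j * Y i j.

Lemma frobC X Y : frob X Y = frob Y X.
Proof. by apply: eq_bigr => i _; apply: eq_bigr => j _; rewrite mulrC. Qed.

Lemma frobDr X Y Z : frob X (Y + Z) = frob X Y + frob X Z.
Proof.
rewrite -big_split; apply: eq_bigr => i _; rewrite -big_split.
by apply: eq_bigr => j _; rewrite mxE mulrDr.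
Qed.

Lemma frobZr (t : R) X Y : frob X (t *: Y) = t * frob X Y.
Proof.
rewrite mulr_sumr; apply: eq_bigr => i _; rewrite mulr_sumr.
by apply: eq_bigr => j _; rewrite mxE mulrCA.
Qed.

Lemma frobNr X Y : frob X (- Y) = - frob X Y.
Proof. by rewrite -scaleN1r frobZr mulN1r. Qed.

Lemma frobDl X Y Z : frob (Y + Z) X = frob Y X + frob Z X.
Proof. by rewrite frobC frobDr !(frobC X). Qed.

Lemma frobZl (t : R) X Y : frob (t *: Y) X = t * frob Y X.
Proof. by rewrite frobC frobZr frobC. Qed.

Lemma frobNl X Y : frob (- Y) X = - frob Y X.
Proof. by rewrite frobC frobNr frobC. Qed.

Lemma frob_ge0 X : 0 <= frob X X.
Proof. by apply: sumr_ge0 => i _; apply: sumr_ge0 => j _; rewrite -expr2 sqr_ge0. Qed.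

Lemma frobenius_normE X : frobenius_norm X = Num.sqrt (frob X X).
Proof. by []. Qed.

Lemma frobenius_norm_ge0 X : 0 <= frobenius_norm X.
Proof. exact: sqrtr_ge0. Qed.

Lemma frobenius_norm_sqr X : frobenius_norm X ^+ 2 = frob X X.
Proof. by rewrite sqr_sqrtr // frob_ge0. Qed.

Lemma frobenius_norm_subC X Y : frobenius_norm (X - Y) = frobenius_norm (Y - X).
Proof. by rewrite !frobenius_normE -opprB frobNl frobNr opprK. Qed.

Lemma frobenius_norm_le X Y :
  (frobenius_norm X <= frobenius_norm Y) = (frob X X <= frob Y Y).
Proof. by rewrite ler_sqrt // frob_ge0. Qed.

Lemma frob_le X Y : frob X Y <= frobenius_norm X * frobenius_norm Y.
Proof.
rewrite !frobenius_normE -sqrtrM ?frob_ge0 //.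
apply: le_trans (ler_norm _) _; rewrite -sqrtr_sqr ler_sqrt ?mulr_ge0 ?frob_ge0 //.
apply: discriminant_le; first exact: frob_ge0.
move=> t; have := frob_ge0 (X + t *: Y).
by rewrite !(frobDl, frobDr, frobZl, frobZr) (frobC Y X); lra.
Qed.

(** Quadratic forms are inner products with rank-one matrices, so that the
    positive semidefinite cone is cut out by half-spaces of [frob]. *)
Lemma frob_rank_one X d e : frob X (d *m e^T) = (d^T *m X *m e) 0 0.
Proof.
rewrite mxE; under [RHS]eq_bigr do rewrite mxE mulr_suml.
rewrite exchange_big; apply: eq_bigr => i _; apply: eq_bigr => j _.
by rewrite !mxE big_ord1 !mxE; ring.
Qed.

(** * The positive semidefinite cone *)

Lemma symmP X : symm X <-> X^T = X.
Proof.
split=> [/is_hermitianmxP|h].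
  by rewrite expr0 scale1r map_mx_id.
by apply/is_hermitianmxP; rewrite expr0 scale1r map_mx_id.
Qed.

Lemma rank_one_psd d : psd_cone (d *m d^T).
Proof.
split=> [|e]; first by apply/symmP; rewrite trmx_mul trmxK.
rewrite mulmxA -mulmxA mxE big_ord1.
have -> : (d^T *m e) = (e^T *m d)^T by rewrite trmx_mul trmxK.
by rewrite [X in _ * X]mxE -expr2 sqr_ge0.
Qed.

Lemma psd_cone0 : psd_cone (0 : 'M[R]_n).
Proof. by split=> [|d]; [apply/symmP; rewrite trmx0|rewrite mulmx0 mul0mx mxE]. Qed.

Lemma psd_coneD X Y : psd_cone X -> psd_cone Y -> psd_cone (X + Y).
Proof.
move=> [/symmP sX pX] [/symmP sY pY]; split.
  by apply/symmP; rewrite linearD /= sX sY.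
by move=> d; rewrite mulmxDr mulmxDl mxE addr_ge0.
Qed.

Lemma psd_coneZ (t : R) X : 0 <= t -> psd_cone X -> psd_cone (t *: X).
Proof.
move=> t0 [/symmP sX pX]; split; first by apply/symmP; rewrite linearZ /= sX.
by move=> d; rewrite -scalemxAr -scalemxAl mxE mulr_ge0.
Qed.

Lemma psd_cauchy_schwarz P d e : psd_cone P ->
  (d^T *m P *m e) 0 0 ^+ 2 <= (d^T *m P *m d) 0 0 * (e^T *m P *m e) 0 0.
Proof.
move=> [/symmP sP pP]; apply: discriminant_le => // t.
have := pP (d + t *: e).
have ed : (e^T *m P *m d) 0 0 = (d^T *m P *m e) 0 0.
  by rewrite -[d^T *m P *m e]trmxK [RHS]mxE !trmx_mul trmxK sP mulmxA.
rewrite -!frob_rank_one in ed *.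
rewrite [(d + _)^T]linearD /= [(t *: e)^T]linearZ /= !(mulmxDl, mulmxDr).
by rewrite -!(scalemxAl, scalemxAr) !(frobDr, frobZr) ed; lra.
Qed.

Lemma psd_diag_ge0 P i : psd_cone P -> 0 <= P i i.
Proof.
move=> [_ /(_ (delta_mx i 0))]; rewrite trmx_delta -rowE -colE.
by rewrite !mxE.
Qed.

(** For a column [p] of [P], [|p|^2] is the value of the form [P] at a basis
    vector and [p].  Cauchy-Schwarz for this form gives
    [|p|^4 <= P i i * (p^T P p)], and [p^T P p], the inner product of [P] with
    [p p^T], is at most [|P| |p|^2].  *)
Lemma psd_column_sqr_le P i : psd_cone P ->
  \sum_j P i j ^+ 2 <= P i i * frobenius_norm P.
Proof.
move=> pP; have [/symmP sP _] := pP.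
have a0 := psd_diag_ge0 i pP.
set q := \sum_j _.
have q0 : 0 <= q by apply: sumr_ge0 => j _; rewrite sqr_ge0.
pose p := col i P.
have pE j : p j 0 = P i j by rewrite mxE -{1}sP mxE.
have pTp : p^T *m p = q%:M.
  apply/matrixP => k l; rewrite !ord1 !mxE mulr1n; apply: eq_bigr => j _.
  by rewrite mxE pE expr2.
have := psd_cauchy_schwarz (delta_mx i 0) p pP.
rewrite -(frob_rank_one P p) trmx_delta -rowE -colE.
have -> : row i P = p^T by rewrite tr_col sP.
rewrite pTp !mxE eqxx mulr1n => h.
have h2 : frob P (p *m p^T) <= frobenius_norm P * q.
  apply: le_trans (frob_le _ _) _; rewrite ler_wpM2l ?frobenius_norm_ge0 //.
  rewrite frobenius_normE frob_rank_one mulmxA pTp -mulmxA pTp -scalar_mxM mxE.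
  by rewrite eqxx mulr1n -expr2 sqrtr_sqr ger0_norm.
have [q1|q1] := lerP q 0.
  by rewrite (le_trans q1) // mulr_ge0 ?frobenius_norm_ge0.
rewrite -(ler_pM2r q1) -expr2; apply: le_trans h _; rewrite -mulrA.
exact: ler_wpM2l.
Qed.

Lemma sum_offdiag_sqr_le (x : 'I_n -> R) i :
  (\sum_(j | j != i) `|x j|) ^+ 2 <= (n%:R - 1) * \sum_(j | j != i) x j ^+ 2.
Proof.
rewrite mulrC; apply: discriminant_le.
  by rewrite subr_ge0 ler1n (leq_ltn_trans _ (ltn_ord i)).
move=> t.
have -> : n%:R - 1 = \sum_(j < n | j != i) 1 :> R.
  have : \sum_(j < n) 1 = n%:R :> R by rewrite sumr_const card_ord.
  by rewrite (bigD1 i) //=; lra.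
rewrite !mulr_sumr -!big_split; apply: sumr_ge0 => j _.
have := sqr_ge0 (`|x j| + t); rewrite sqrrD real_normK ?num_real //=; lra.
Qed.

(** With [a = P i i], [f = |P|], [s = sqrt n] and [S] the off-diagonal row sum,
    [S^2 <= (s^2 - 1) (a f - a^2)], and [(a + f (s - 1) / 2)^2] exceeds this
    bound by the square of [s a - (s - 1) f / 2]. *)
Lemma psd_offdiag_le P i : psd_cone P ->
  \sum_(j | j != i) `|P i j| - P i i <=
  frobenius_norm P * ((Num.sqrt n%:R - 1) / 2).
Proof.
move=> pP; have a0 := psd_diag_ge0 i pP.
have f0 := frobenius_norm_ge0 P.
have := psd_column_sqr_le i pP; rewrite (bigD1 i) //=.
have := sum_offdiag_sqr_le (P i) i.
set S := \sum_(j | _) _; set q := \sum_(j | _) _.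
move: (P i i) (frobenius_norm P) a0 f0 => a f a0 f0.
have n1 : 1 <= n%:R :> R by rewrite ler1n (leq_ltn_trans _ (ltn_ord i)).
have s1 : 1 <= Num.sqrt n%:R :> R by rewrite -[leLHS]sqrtr1 ler_sqrt ?(le_trans _ n1).
have ss : Num.sqrt n%:R ^+ 2 = n%:R :> R by rewrite sqr_sqrtr.
move: (Num.sqrt _) s1 ss => s s1 ss h1 h2.
rewrite lerBlDl; apply: le_trans (ler_norm _) _.
have r0 : 0 <= a + f * ((s - 1) / 2) by rewrite addr_ge0 ?mulr_ge0 ?divr_ge0 ?subr_ge0.
rewrite -(ger0_norm r0) -ler_sqr ?nnegrE //.
rewrite !real_normK ?num_real //; apply: le_trans h1 _.
have h3 : (n%:R - 1) * q <= (n%:R - 1) * (a * f - a ^+ 2).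
  by apply: ler_wpM2l; lra.
apply: le_trans h3 _; rewrite -ss -subr_ge0.
rewrite (_ : _ - _ = (s * a - (s - 1) * f / 2) ^+ 2) ?sqr_ge0 //.
by field.
Qed.

(** * Matrices in the dual of the diagonally dominant cone *)

Lemma dd_dual_diag_ge0 X i : dd_dual X -> 0 <= X i i.
Proof. by move=> [_ /(_ i i (leqnn i))]; lra. Qed.

Lemma dd_dual_entry_le X i j : dd_dual X -> `|X i j| <= (X i i + X j j) / 2.
Proof.
move=> [/symmP sX h]; wlog ij : i j / (i <= j)%N => [W|].
  have [/W //|/ltnW /W] := leqP i j.
  by rewrite -{1}sX mxE [X j j + _]addrC.
by have := h i j ij; rewrite ler_norml; lra.
Qed.

(** The duality estimate: as [- frob X P] is at most a sum of terms linear in the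
    diagonal of [X], each [X i i] gets the factor bounded in
    [psd_offdiag_le]. *)
Lemma dd_dual_frob_ge X P : dd_dual X -> psd_cone P ->
  - frob X P <= \tr X * (frobenius_norm P * ((Num.sqrt n%:R - 1) / 2)).
Proof.
move=> dX pP; have [/symmP sP _] := pP.
(* The bound on -X i j * P i j is (X i i + X j j) / 2 * G i j: on the diagonal
   the sign of P i i is kept, off it only the absolute value is under control. *)
pose G i j := if j == i then - P i i else `|P i j|.
have GC i j : G i j = G j i.
  rewrite /G eq_sym; case: eqP => [->//|_].
  by rewrite -[in LHS]sP mxE.
apply: (@le_trans _ _ (\sum_i \sum_j (X i i + X j j) / 2 * G i j)).
  rewrite -sumrN; apply: ler_sum => i _; rewrite -sumrN; apply: ler_sum => j _.
  rewrite /G; case: eqP => [->|_]; first by lra.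
  apply: le_trans (ler_norm _) _; rewrite normrN normrM.
  by apply: ler_wpM2r => //; exact: dd_dual_entry_le.
have -> : \sum_i \sum_j (X i i + X j j) / 2 * G i j = \sum_i X i i * \sum_j G i j.
  have e : \sum_i \sum_j X j j / 2 * G i j = \sum_i \sum_j X i i / 2 * G i j.
    by rewrite exchange_big; do 2![apply: eq_bigr => ? _]; rewrite GC.
  transitivity (\sum_i \sum_j X i i / 2 * G i j + \sum_i \sum_j X j j / 2 * G i j).
    rewrite -big_split; apply: eq_bigr => i _; rewrite -big_split.
    by apply: eq_bigr => j _ /=; lra.
  rewrite e -big_split; apply: eq_bigr => i _; rewrite -big_split mulr_sumr.
  by apply: eq_bigr => j _ /=; lra.
rewrite mulr_suml; apply: ler_sum => i _.
apply: ler_wpM2l; first exact: dd_dual_diag_ge0.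
rewrite (bigD1 i) //= {1}/G eqxx addrC.
rewrite (eq_bigr (fun j => `|P i j|)); first exact: psd_offdiag_le.
by move=> j ji; rewrite /G (negbTE ji).
Qed.

(** * The projection on the positive semidefinite cone *)

(** The segment from [Y] to [Z] stays in the cone, so the squared distance to
    [X] has a nonnegative derivative at [Y] along it. *)
Lemma is_psd_proj_variational X Y Z : is_psd_proj X Y -> psd_cone Z ->
  0 <= frob (Y - X) (Z - Y).
Proof.
move=> [pY minY] pZ.
apply: (@unit_interval_quadratic_ge0 _ _ (frob (Z - Y) (Z - Y))) => t /andP[t0 t1].
have pW : psd_cone (t *: Z + (1 - t) *: Y).
  by apply: psd_coneD; apply: psd_coneZ => //; rewrite subr_ge0.
have := minY _ pW; rewrite frobenius_norm_le.
have -> : X - (t *: Z + (1 - t) *: Y) = (X - Y) - t *: (Z - Y).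
  by apply/matrixP => i j; rewrite !mxE; ring.
rewrite -(opprB X Y) frobNl; move: (X - Y) (Z - Y) => U V.
by rewrite !(frobDl, frobDr, frobNl, frobNr, frobZl, frobZr) (frobC V U); lra.
Qed.

(** The variational inequality at [Z = Y + d d^T] bounds the quadratic form of
    the residual at [d] below by zero. *)
Lemma psd_proj_residual_psd X Y : symm X -> is_psd_proj X Y -> psd_cone (Y - X).
Proof.
move=> /symmP sX YX; have [[/symmP sY _] _] := YX.
split=> [|d]; first by apply/symmP; rewrite linearB /= sX sY.
rewrite -frob_rank_one.
have := is_psd_proj_variational YX (psd_coneD YX.1 (rank_one_psd d)).
by rewrite [Y + d *m _]addrC addrK.
Qed.

(** The variational inequality at [Z = 0] gives [frob (Y - X) Y <= 0], one half
    of the orthogonality of the residual to the projection. *)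
Lemma psd_proj_dist_sqr_le X Y : is_psd_proj X Y ->
  frobenius_norm (X - Y) ^+ 2 <= - frob X (Y - X).
Proof.
move=> YX; have := is_psd_proj_variational YX psd_cone0.
rewrite sub0r frobenius_norm_sqr !(frobDl, frobDr, frobNl, frobNr) (frobC Y X).
by lra.
Qed.

Lemma psd_proj_dist_le X Y : dd_dual X -> \tr X = 1 -> is_psd_proj X Y ->
  frobenius_norm (X - Y) <= (Num.sqrt n%:R - 1) / 2.
Proof.
move=> dX tX YX; have pP := psd_proj_residual_psd dX.1 YX.
have := le_trans (psd_proj_dist_sqr_le YX) (dd_dual_frob_ge dX pP).
rewrite (frobenius_norm_subC Y) tX mul1r expr2.
have [f0|f0 _] := ltrP 0 (frobenius_norm (X - Y)); first by rewrite ler_pM2l.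
apply: (le_trans f0); rewrite divr_ge0 // subr_ge0 -[leLHS]sqrtr1 ler_sqrt // ler1n.
(* The empty matrix has trace 0, so n > 0. *)
case: (n) X tX {Y dX YX pP f0} => // X.
by rewrite /mxtrace big_ord0 => /eqP; rewrite eq_sym oner_eq0.
Qed.

(** The inner product of [Y - X] with [v v^T] is at least [- v^T X v = l |v|^2],
    because [Y] is nonnegative on [v], and at most [|X - Y| |v|^2]. *)
Lemma eigenvalue_dist_psd_ge X Y (v : 'cV[R]_n) (l : R) :
  X *m v = - l *: v -> v != 0 -> psd_cone Y -> l <= frobenius_norm (X - Y).
Proof.
move=> Xv v0 [_ /(_ v) pY].
have vvE : (v^T *m v) 0 0 = \sum_i v i 0 ^+ 2.
  by rewrite mxE; apply: eq_bigr => i _; rewrite mxE expr2.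
have vv : 0 < (v^T *m v) 0 0.
  rewrite vvE lt0r sumr_ge0 ?andbT => [|i _]; last exact: sqr_ge0.
  apply: contra v0; rewrite psumr_eq0 => [/allP h|i _]; last exact: sqr_ge0.
  apply/eqP/matrixP => i j; rewrite ord1 mxE; apply/eqP.
  by have := h i (mem_index_enum i); rewrite sqrf_eq0.
have norm_vv : frobenius_norm (v *m v^T) = (v^T *m v) 0 0.
  rewrite frobenius_normE frob_rank_one mulmxA -mulmxA.
  by rewrite [X in Num.sqrt X]mxE big_ord1 -expr2 sqrtr_sqr gtr0_norm.
rewrite -(ler_pM2r vv) -[in leRHS]norm_vv frobenius_norm_subC.
apply: le_trans (frob_le _ _).
rewrite frobDl frobNl !frob_rank_one.
have -> : (v^T *m X *m v) 0 0 = - l * (v^T *m v) 0 0.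
  by rewrite -mulmxA Xv -scalemxAr mxE.
by rewrite mulNr opprK lerDr.
Qed.

(** A minimiser need only be sought among the matrices of the cone that are at
    least as close to [X] as [0] is; these form a closed bounded set.  Matrices
    are handled as row vectors of length [n * n], for which closed bounded sets
    are known to be compact. *)
Lemma psd_proj_exists X : exists Y, is_psd_proj X Y.
Proof.
pose f (v : 'rV[R]_(n * n)) := frob (X - vec_mx v) (X - vec_mx v).
have cE i j : continuous (fun v : 'rV[R]_(n * n) => vec_mx v i j).
  under eq_fun do rewrite mxE.
  exact: coord_continuous.
have csum (F : 'I_n -> 'I_n -> 'rV[R]_(n * n) -> R) :
    (forall i j, continuous (F i j)) ->
    continuous (fun v => \sum_i \sum_j F i j v).
  move=> cF; apply: continuous_big => [x|i _]; first exact: add_continuous.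
  apply: continuous_big => [x|j _]; first exact: add_continuous.
  exact: cF.
have cB i j : continuous (fun v : 'rV[R]_(n * n) => (X - vec_mx v) i j).
  under eq_fun do rewrite mxE [in X in _ + X]mxE.
  by move=> v; exact: (cvgB (cvg_cst _) (@cE i j v)).
have cf : continuous f by apply: csum => i j v; exact: (cvgM (@cB i j v) (@cB i j v)).
have closed_nonneg (g : 'rV[R]_(n * n) -> R) : continuous g ->
    closed [set v | 0 <= g v].
  by move=> cg; apply: (@preimage_closed _ _ g [set x | 0 <= x]) => //; exact: closed_ge.
pose A := [set v | psd_cone (vec_mx v) /\ f v <= f 0].
have clA : closed A.
  rewrite (_ : A = (\bigcap_(p in [set: 'I_n * 'I_n])
      [set v | 0 <= vec_mx v p.1 p.2 - vec_mx v p.2 p.1]) `&`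
    (\bigcap_(d in [set: 'cV[R]_n]) [set v | 0 <= frob (vec_mx v) (d *m d^T)])
    `&` [set v | 0 <= f 0 - f v]).
    apply: closedI; first apply: closedI.
    - apply: closed_bigI => p _; apply: closed_nonneg => v.
      exact: (cvgB (@cE p.1 p.2 v) (@cE p.2 p.1 v)).
    - apply: closed_bigI => d _; apply: closed_nonneg; apply: csum => i j v.
      exact: (cvgM (@cE i j v) (cvg_cst _)).
    - by apply: closed_nonneg => v; exact: (cvgB (cvg_cst _) (cf v)).
  apply/seteqP; split=> v /=.
    move=> [[/symmP sv pv] fv]; split; last by rewrite subr_ge0.
    split=> [[i j] _ /=|d _ /=]; last by rewrite frob_rank_one.
    by rewrite -{1}sv mxE subrr.
  move=> [[sv pv] fv]; split; last by rewrite -subr_ge0.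
  split=> [|d]; last by rewrite -frob_rank_one; exact: pv.
  apply/symmP/matrixP => i j; rewrite mxE.
  by have := sv (i, j) I; have := sv (j, i) I => /=; lra.
(* Each entry is within the Frobenius distance of the entry of X, and the
   entries of X are bounded by the sum of their absolute values. *)
have bA : bounded_set A.
  exists (Num.sqrt (f 0) + \sum_i \sum_j `|X i j|); split; first exact: num_real.
  move=> M /ltW hM v [_ fv]; apply: le_trans hM.
  rewrite [leLHS]mx_normrE; apply/bigmax_leP; split.
    by rewrite addr_ge0 ?sqrtr_ge0 // sumr_ge0 // => i _; rewrite sumr_ge0.
  move=> [k l] _ /=; rewrite ord1; case/mxvec_indexP: l => i j.
  have -> : v 0 (mxvec_index i j) = vec_mx v i j by rewrite mxE.
  have h1 : `|X i j - vec_mx v i j| <= Num.sqrt (f 0).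
    rewrite -sqrtr_sqr ler_sqrt ?frob_ge0 //; apply: le_trans fv.
    rewrite /f /frob (bigD1 i) //= (bigD1 j) //= !mxE -expr2 -addrA lerDl.
    rewrite addr_ge0 // sumr_ge0 // => *; rewrite ?sumr_ge0 // => *;
      by rewrite -expr2 sqr_ge0.
  have h2 : `|X i j| <= \sum_i \sum_j `|X i j|.
    rewrite (bigD1 i) //= (bigD1 j) //= -addrA lerDl.
    by rewrite addr_ge0 // sumr_ge0 // => *; rewrite sumr_ge0.
  have -> : vec_mx v i j = X i j - (X i j - vec_mx v i j) by ring.
  by apply: le_trans (ler_normB _ _) _; rewrite addrC lerD.
have A0 : A 0 by split; rewrite ?linear0 //; exact: psd_cone0.
have [v vA minv] := @EVT_min_rV R (n * n) f A (ex_intro _ _ A0)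
  (bounded_closed_compact bA clA) (continuous_subspaceT cf).
move: vA; rewrite inE => -[pv fv].
exists (vec_mx v); split=> // Z pZ.
rewrite frobenius_norm_le.
have fZ : frob (X - Z) (X - Z) = f (mxvec Z) by rewrite /f mxvecK.
rewrite fZ; have [h|/ltW h] := lerP (f (mxvec Z)) (f 0); last exact: le_trans h.
by apply: minv; rewrite inE; split=> //; rewrite mxvecK.
Qed.

Lemma psd_projP X : is_psd_proj X (psd_proj X).
Proof. by have [Y YX] := psd_proj_exists X; exact: (xgetPex 0 (ex_intro _ Y YX)). Qed.

End FrobeniusProduct.

(** * The extremal matrix *)

Section Star.
Context {R : realType} {n : nat}.
Variable i0 : 'I_n.

Definition star : 'M[R]_n := \matrix_(i, j)
  if i == i0 then if j == i0 then 1 else - 2^-1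
  else if j == i0 then - 2^-1 else 0.

Lemma star_dd_dual : dd_dual star.
Proof.
split=> [|i j _].
  by apply/symmP/matrixP => i j; rewrite !mxE; do 2!case: eqP.
by rewrite !mxE; do 2!case: eqP => _; split; lra.
Qed.

Lemma star_trace : \tr star = 1.
Proof.
rewrite /mxtrace (bigD1 i0) //= mxE eqxx big1 ?addr0 // => i ii0.
by rewrite mxE (negbTE ii0).
Qed.

Definition star_eigenvector : 'cV[R]_n :=
  \col_i if i == i0 then Num.sqrt n%:R - 1 else 1.

Lemma star_eigen :
  star *m star_eigenvector =
  - ((Num.sqrt n%:R - 1) / 2) *: star_eigenvector.
Proof.
have ss : Num.sqrt n%:R ^+ 2 = n%:R :> R by rewrite sqr_sqrtr.
have nE : \sum_(j < n | j != i0) 1 = n%:R - 1 :> R.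
  have : \sum_(j < n) 1 = n%:R :> R by rewrite sumr_const card_ord.
  by rewrite (bigD1 i0) //=; lra.
apply/matrixP => i k; rewrite !mxE (bigD1 i0) //= !mxE eqxx.
have [->|ii0] := eqVneq i i0.
  rewrite (eq_bigr (fun=> - 2^-1 * 1)) => [|j ji0].
    by rewrite -mulr_sumr nE; move: ss; set s := Num.sqrt _ => <-; field.
  by rewrite !mxE eqxx (negbTE ji0).
rewrite big1 => [|j ji0]; first by field.
by rewrite !mxE (negbTE ii0) (negbTE ji0) mul0r.
Qed.

End Star.

Theorem theorem3 (R : realType) (n : nat) (hn : (2 <= n)%N) :
  trace_dist (@dd_dual R n) = (((Num.sqrt n%:R - 1) / 2)%:E)%E.
Proof.
apply/eqP; rewrite eq_le; apply/andP; split.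
  apply: ge_ereal_sup => _ [X [dX tX] <-]; rewrite lee_fin.
  exact: psd_proj_dist_le (psd_projP X).
pose i0 := Ordinal (ltnW hn); pose i1 := Ordinal hn.
apply: (@le_trans _ _ (frobenius_norm (star i0 - psd_proj (star i0)))%:E).
  rewrite lee_fin; apply: eigenvalue_dist_psd_ge (star_eigen i0) _ _.
    apply/eqP => /matrixP /(_ i1 0); rewrite !mxE /= => /eqP.
    by rewrite oner_eq0.
  exact: (psd_projP _).1.
apply: ereal_sup_ubound; exists (star i0) => //.
by split; [exact: star_dd_dual|exact: star_trace].
Qed.
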